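(* For every integer $n\geq 1$, $f_{\leq 1}^n=2^{n-1}$.
   Context: All posets are finite. A semiorder is a poset with no induced subposet isomorphic to $\mathbf{2}+\mathbf{2}$ (disjoint union of two 2-element chains with no other comparabilities) or $\mathbf{3}+\mathbf{1}$ (disjoint union of a 3-element chain and a single incomparable element). Its length is the length of a longest chain (a chain with $\ell+1$ elements has length $\ell$). $f_{\leq 1}^n$ denotes the number of nonisomorphic unlabeled semiorders with $n$ elements and length at most $1$. *)

(* Defs.v *)
From mathcomp Require Import all_boot all_fingroup.

Set Implicit Arguments.
Unset Strict Implicit.
Unset Printing Implicit Defensive.

(* Orders are non-strict.  All predicates are boolean, so that the posets on a
   finite type can be collected in a finite set and counted. *)
Definition is_porder (T : finType) (r : rel T) : bool :=
  [&& [forall x, r x x],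
      [forall x, forall y, r x y && r y x ==> (x == y)]
    & [forall x, forall y, forall z, r x y && r y z ==> r x z]].

Lemma is_porderP (T : finType) (r : rel T) :
  reflect [/\ reflexive r, antisymmetric r & transitive r] (is_porder r).
Proof.
apply: (iffP and3P) => [[rr ra rt]|[rr ra rt]].
- split=> [x|x y rxy|y x z rxy ryz].
  + exact: (forallP rr).
  + exact/eqP/(implyP (forallP (forallP ra x) y)).
  + by apply: (implyP (forallP (forallP (forallP rt x) y) z)); rewrite rxy.
- split; apply/forallP=> x; first exact: rr.
  + by apply/forallP=> y; apply/implyP=> /ra ->.
  + apply/forallP=> y; apply/forallP=> z.
    by apply/implyP=> /andP[]; apply: rt.
Qed.

(* The chain with k elements, written as a bold k in the literature. *)
Definition chain_rel (k : nat) : rel 'I_k := fun i j => i <= j.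

Definition disjoint_union (S T : finType) (r : rel S) (s : rel T) :
    rel (S + T)%type :=
  fun u v => match u, v with
             | inl x, inl y => r x y
             | inr x, inr y => s x y
             | _, _ => false
             end.

(* (T, r) has an induced subposet isomorphic to (S, s). *)
Definition has_induced (S T : finType) (s : rel S) (r : rel T) : bool :=
  [exists f : {ffun S -> T},
     injectiveb f && [forall x, forall y, r (f x) (f y) == s x y]].

Definition is_semiorder (T : finType) (r : rel T) : bool :=
  [&& is_porder r,
      ~~ has_induced (disjoint_union (@chain_rel 2) (@chain_rel 2)) r
    & ~~ has_induced (disjoint_union (@chain_rel 3) (@chain_rel 1)) r].

Definition is_chain (T : finType) (r : rel T) (A : {set T}) : bool :=
  [forall x in A, forall y in A, r x y || r y x].

(* On the empty poset this is 0. *)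
Definition poset_length (T : finType) (r : rel T) : nat :=
  \max_(A : {set T} | is_chain r A) #|A|.-1.

Definition poset_iso (T : finType) (r s : rel T) : bool :=
  [exists f : {perm T}, forall x, forall y, s (f x) (f y) == r x y].

(* The relation with graph R. *)
Definition rel_of (T : finType) (R : {set T * T}) : rel T :=
  fun x y => (x, y) \in R.

Definition graph_iso (T : finType) : rel {set T * T} :=
  fun R S => poset_iso (rel_of R) (rel_of S).

Lemma graph_iso_equiv (T : finType) : equivalence_rel (@graph_iso T).
Proof.
apply/equivalence_relP; split=> [R|R S /existsP[f /'forall_'forall_eqP fP] Q].
  by apply/existsP; exists 1%g; apply/'forall_'forall_eqP=> x y; rewrite !perm1.
apply/existsP/existsP=> -[g /'forall_'forall_eqP gP].
- exists (f^-1 * g)%g; apply/'forall_'forall_eqP=> x y.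
  by rewrite !permM gP -fP !permKV.
- exists (f * g)%g; apply/'forall_'forall_eqP=> x y.
  by rewrite !permM gP fP.
Qed.

(* Semiorders on 'I_n of length at most l, as graphs of their orders. *)
Definition semiorders_length_le (l n : nat) : {set {set 'I_n * 'I_n}} :=
  [set R | is_semiorder (rel_of R) & poset_length (rel_of R) <= l].

(* The number of isomorphism classes of semiorders with n elements and length
   at most l: every n-element poset is isomorphic to one on 'I_n. *)
Definition num_semiorders_length_le (l n : nat) : nat :=
  #|equivalence_partition (@graph_iso 'I_n) (semiorders_length_le l n)|.

(* Main.v *)
Require Import Defs.
From mathcomp Require Import all_boot all_fingroup.
From mathcomp Require Import zify.

Set Implicit Arguments.
Unset Strict Implicit.
Unset Printing Implicit Defensive.

(* A word w of bits gives a poset of length at most 1 on its positions, i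
    lying strictly below j when i < j, w_i = 0 and w_j = 1; such a poset is a
    semiorder.  Conversely, a (2+2)-free poset has nested strict lower sets, and
    when its length is at most 1 its elements can be lined up so that it becomes
    the poset of a word whose 1s are its nonminimal elements.  The first letter
    is then 0, and a word beginning with 0 can be read off the numbers of
    elements with k elements strictly below, k > 0.  So isomorphism classes
    correspond to the words of length n beginning with 0. *)

Definition word_rel (n : nat) (w : seq bool) : rel 'I_n :=
  fun i j => (i == j) || [&& i < j, ~~ nth false w i & nth false w j].

Definition word_graph (n : nat) (w : seq bool) : {set 'I_n * 'I_n} :=
  [set p | word_rel w p.1 p.2].

Definition strict_down (T : finType) (r : rel T) (y : T) : {set T} :=
  [set x | r x y && (x != y)].

Lemma rel_of_word_graph n w : rel_of (word_graph n w) =2 word_rel w.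
Proof. by move=> i j; rewrite /rel_of inE. Qed.

(** * Posets of words *)

Lemma word_rel_porder n w : is_porder (@word_rel n w).
Proof.
apply/is_porderP; split=> [i|i j|j i k]; first by rewrite /word_rel eqxx.
- rewrite /word_rel => /andP[/orP[/eqP//|/and3P[_ wi wj]]].
  by case/orP=> [/eqP//|/and3P[_ /negP]].
- rewrite /word_rel => /orP[/eqP->//|/and3P[ij wi wj]].
  by case/orP=> [/eqP<-|/and3P[_ /negP//]]; rewrite ij wi wj orbT.
Qed.

Lemma eq_is_semiorder (T : finType) (r s : rel T) :
  r =2 s -> is_semiorder r -> is_semiorder s.
Proof.
move=> rs /and3P[/is_porderP[r1 r2 r3] no22 no31]; apply/and3P; split.
- apply/is_porderP; split=> [x|x y|y x z]; rewrite -!rs //; first exact: r2.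
  exact: r3.
- apply: contra no22 => /existsP[f /andP[fI /'forall_'forall_eqP fE]].
  apply/existsP; exists f; rewrite fI; apply/'forall_'forall_eqP=> x y.
  by rewrite rs.
- apply: contra no31 => /existsP[f /andP[fI /'forall_'forall_eqP fE]].
  apply/existsP; exists f; rewrite fI; apply/'forall_'forall_eqP=> x y.
  by rewrite rs.
Qed.

Lemma word_rel_strict n w (i j : 'I_n) :
  word_rel w i j -> ~~ word_rel w j i ->
  [&& i < j, ~~ nth false w i & nth false w j].
Proof.
rewrite /word_rel eq_sym negb_or => ij /andP[/negPf ne _].
by rewrite ne in ij.
Qed.

(** In an induced [2+2] with chains [a < b] and [c < e], the missing relations force the positions
    [a < b <= c < e <= a]. In a 3-element chain the middle letter would be both 1 and 0. *)
Lemma word_rel_semiorder n w : is_semiorder (@word_rel n w).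
Proof.
apply/and3P; split; first exact: word_rel_porder.
- apply/existsP=> -[f /andP[_ /'forall_'forall_eqP fE]].
  pose a := f (inl ord0); pose b := f (inl ord_max).
  pose c := f (inr ord0); pose e := f (inr ord_max).
  have ab : [&& a < b, ~~ nth false w a & nth false w b].
    by apply: word_rel_strict; rewrite fE.
  have ce : [&& c < e, ~~ nth false w c & nth false w e].
    by apply: word_rel_strict; rewrite fE.
  have /norP[_ ae] : ~~ word_rel w a e by rewrite fE.
  have /norP[_ cb] : ~~ word_rel w c b by rewrite fE.
  by lia.
- apply/existsP=> -[f /andP[_ /'forall_'forall_eqP fE]].
  pose a := f (inl ord0); pose b := f (inl (inord 1)).
  pose c := f (inl ord_max).
  have /and3P[_ _ wb] : [&& a < b, ~~ nth false w a & nth false w b].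
    by apply: word_rel_strict; rewrite fE /= /chain_rel /= inordK.
  have /and3P[_ /negP] : [&& b < c, ~~ nth false w b & nth false w c].
    by apply: word_rel_strict; rewrite fE /= /chain_rel /= inordK.
  by [].
Qed.

(** Distinct elements with the same letter are incomparable, so the letters inject a chain into
    [bool]. *)
Lemma poset_length_word_rel n w : poset_length (@word_rel n w) <= 1.
Proof.
apply/bigmax_leqP=> A /'forall_in_'forall_in_orP chA.
suff: #|A| <= #|{: bool}| by rewrite card_bool; lia.
apply: (@leq_card_in _ _ (fun i : 'I_n => nth false w i)) => // i j iA jA wij.
apply/eqP; have := chA i iA j jA; rewrite /word_rel wij eq_sym andNb !andbF.
by rewrite !orbF => -[].
Qed.

Lemma eq_poset_length (T : finType) (r s : rel T) :
  r =2 s -> poset_length r = poset_length s.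
Proof.
move=> rs; apply: eq_bigl => A; apply: eq_forallb => x; congr (_ ==> _).
by apply: eq_forallb => y; rewrite !rs.
Qed.

Lemma word_graph_semiorder n w : word_graph n w \in semiorders_length_le 1 n.
Proof.
have E := rel_of_word_graph (n:=n) w.
rewrite inE (eq_poset_length E) poset_length_word_rel andbT.
by apply: eq_is_semiorder (word_rel_semiorder n w) => i j; rewrite E.
Qed.

(** * Recovering the word *)

Definition zeros_before (w : seq bool) (j : nat) : nat :=
  count (fun i => (i < j) && ~~ nth false w i) (iota 0 (size w)).

(** The lengths, possibly 0, of the runs of 1s, indexed by the number of 0s that precede them. *)
Definition profile (w : seq bool) (k : nat) : nat :=
  count (fun j => nth false w j && (zeros_before w j == k)) (iota 0 (size w)).

Lemma zeros_before_cons b w j :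
  zeros_before (b :: w) j.+1 = ~~ b + zeros_before w j.
Proof. by rewrite /zeros_before /= -[1]addn0 iotaDl count_map. Qed.

Lemma profile_cons b w k :
  profile (b :: w) k =
  (b && (k == 0)) + (if ~~ b && (k == 0) then 0 else profile w (k - ~~ b)).
Proof.
rewrite {1}/profile /= -[1]addn0 iotaDl count_map.
have -> : zeros_before (b :: w) 0 = 0 by exact: count_pred0.
rewrite eq_sym; congr (_ + _).
case: ifP => [/andP[nb /eqP->]|bk].
  rewrite -[RHS](count_pred0 (iota 0 (size w))); apply: eq_count => j /=.
  by rewrite zeros_before_cons nb andbF.
apply: eq_count => j /=; rewrite zeros_before_cons; congr (_ && _).
by apply/eqP/eqP; case: (b) bk => /=; lia.
Qed.

(** The value at 0 is positive exactly when the first letter is 1; that letter is then removed.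
    Sizes must agree because trailing 0s leave no trace in the profile. *)
Lemma profile_inj v w : size v = size w -> profile v =1 profile w -> v = w.
Proof.
elim: v w => [|b v IHv] [|c w] //= [/IHv{}IHv] pvw.
have bc : b = c.
  have := pvw 0; rewrite !profile_cons.
  by case: (b) (c) => -[]; rewrite //= ?subn0; lia.
subst c; congr (_ :: _); apply: IHv => k.
have := pvw (k + ~~ b); rewrite !profile_cons.
by case: (b) => /=; [rewrite !addn0 !subn0; lia | rewrite addn1 /= !subn1].
Qed.

Lemma card_ord_count n (p : pred nat) :
  #|[set i : 'I_n | p i]| = count p (iota 0 n).
Proof. by rewrite cardsE cardE size_filter -enumT -val_enum_ord count_map. Qed.

Lemma card_strict_down_word_rel w (j : 'I_(size w)) :
  #|strict_down (word_rel w) j| = if nth false w j then zeros_before w j else 0.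
Proof.
case: ifP => wj; last first.
  apply/eqP; rewrite cards_eq0; apply/eqP/setP=> i; rewrite !inE /word_rel wj.
  by rewrite !andbF orbF andbN.
rewrite /zeros_before -card_ord_count; apply: eq_card => i.
rewrite !inE /word_rel wj andbT.
by have [->|_] := eqVneq i j; rewrite ?ltnn ?andbT.
Qed.

Lemma poset_iso_card_strict_down (T : finType) (r s : rel T) k :
  poset_iso r s ->
  #|[set y | #|strict_down r y| == k]| = #|[set y | #|strict_down s y| == k]|.
Proof.
case/existsP=> f /'forall_'forall_eqP fE.
have dE y : #|strict_down s (f y)| = #|strict_down r y|.
  rewrite -[RHS](card_imset _ (@perm_inj _ f)); apply: eq_card => x.
  rewrite -[x](permKV f) mem_imset; last exact: perm_inj.
  by rewrite !inE fE (inj_eq perm_inj).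
rewrite -[LHS](card_imset _ (@perm_inj _ f)); apply: eq_card => y.
rewrite -[y](permKV f) mem_imset; last exact: perm_inj.
by rewrite !inE dE.
Qed.

(** Only positive values are matched: at 0 the left side would also count the 0s of the word. *)
Lemma card_strict_down_profile w k :
  #|[set y | #|strict_down (@word_rel (size w) w) y| == k.+1]| = profile w k.+1.
Proof.
rewrite /profile -card_ord_count; apply: eq_card => j; rewrite !inE.
by rewrite card_strict_down_word_rel; case: ifP.
Qed.

Lemma word_rel_iso_inj v w : size v = size w ->
  poset_iso (@word_rel (size v).+1 (false :: v)) (word_rel (false :: w)) ->
  v = w.
Proof.
move=> vw iso_vw; suff [] : false :: v = false :: w by [].
(* The value at 0, which the poset does not reveal, vanishes for both words because of the leading
   0. *)
apply: profile_inj => [|[|k]]; [by rewrite /= vw | by rewrite !profile_cons |].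
rewrite -!card_strict_down_profile (poset_iso_card_strict_down _ iso_vw) /=.
by rewrite vw.
Qed.

(** * Lining up a semiorder of length at most 1 *)

Section LengthOne.

Variables (T : finType) (r : rel T).
Hypotheses (semi_r : is_semiorder r) (len_r : poset_length r <= 1).

Let lt : rel T := fun x y => r x y && (x != y).
Let d (y : T) : nat := #|strict_down r y|.

(** If both relations failed, the two chains would form an induced [2+2]. The conclusion is
    non-strict since [a = e] or [c = b] may occur. *)
Lemma semiorder_interval a b c e :
  lt a b -> lt c e -> r a e || r c b.
Proof.
have /and3P[/is_porderP[r_refl r_anti r_trans] no22 _] := semi_r.
move=> /andP[ab nab] /andP[ce nce]; apply: contraR no22; rewrite negb_or.
case/andP=> nae ncb; apply/existsP.
have nba : ~~ r b a by apply: contra nab => ba; apply/eqP/r_anti; rewrite ab.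
have nec : ~~ r e c by apply: contra nce => ec; apply/eqP/r_anti; rewrite ce.
(* Any other relation between the two chains would yield [r a e] or [r c b] by transitivity. *)
have nac : ~~ r a c by apply: contra nae => /r_trans; apply.
have nca : ~~ r c a by apply: contra ncb => /r_trans; apply.
have nbe : ~~ r b e by apply: contra nae => /(r_trans _ _ _ ab).
have neb : ~~ r e b by apply: contra ncb => /(r_trans _ _ _ ce).
have nea : ~~ r e a by apply: contra nca => /(r_trans _ _ _ ce).
have nbc : ~~ r b c by apply: contra nac => /(r_trans _ _ _ ab).
pose f : {ffun 'I_2 + 'I_2 -> T} := [ffun u => match u with
  | inl i => if i == ord0 then a else b
  | inr i => if i == ord0 then c else e end].
have fE u v : r (f u) (f v) = disjoint_union (@chain_rel 2) (@chain_rel 2) u v.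
  rewrite !ffunE /disjoint_union /chain_rel.
  by case: u v => -[[|[|[]]] //= ?] [] [[|[|[]]] //= ?];
    rewrite ?r_refl //; first [exact: negbTE | idtac].
exists f; apply/andP; split; last by apply/'forall_'forall_eqP.
apply/injectiveP=> u v fuv.
(* Reflexivity at the common image relates [u] and [v] both ways, hence they are equal. *)
have := fE u v; have := fE v u; rewrite fuv r_refl.
case: (u) (v) => i [] j //= /esym; rewrite /chain_rel => ji /esym ij.
  by congr inl; apply/val_inj/eqP; rewrite eqn_leq ij.
by congr inr; apply/val_inj/eqP; rewrite eqn_leq ij.
Qed.

Lemma length1_no_chain x y z : lt x y -> ~~ lt y z.
Proof.
have /and3P[/is_porderP[r_refl r_anti r_trans] _ _] := semi_r.
move=> /andP[xy nxy]; apply/negP=> /andP[yz nyz].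
have xz := r_trans _ _ _ xy yz.
have nxz : x != z.
  by apply: contra nxy => /eqP exz; apply/eqP/r_anti; rewrite xy exz yz.
have ch : is_chain r [set x; y; z].
  apply/'forall_in_'forall_in_orP => u; rewrite !inE -orbA => /or3P[]/eqP-> v;
  by rewrite !inE -orbA => /or3P[]/eqP->; rewrite ?r_refl ?xy ?yz ?xz; auto.
have := leq_trans (leq_bigmax_cond _ ch) len_r.
by rewrite -setUA !cardsU1 cards1 !inE negb_or nxy nxz nyz.
Qed.

(** The strict lower set of [z] lies in that of [y], and [x] is only in the latter. The equality
    cases of [semiorder_interval] are excluded, as each gives a 3-element chain. *)
Lemma strict_down_nested x y z : lt x y -> ~~ lt x z -> d z < d y.
Proof.
have /and3P[/is_porderP[r_refl r_anti r_trans] _ _] := semi_r.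
move=> xy nxz; apply: proper_card; apply/properP; split; last first.
  by exists x; rewrite inE.
apply/subsetP=> c; rewrite !inE => cz; have := semiorder_interval xy cz.
case/orP=> [xz|cy].
  have exz : x = z by apply/eqP; move: nxz; rewrite /lt xz negbK.
  by have := length1_no_chain y cz; rewrite -exz xy.
rewrite cy; apply: contraNneq nxz => ecy; subst c.
by have := length1_no_chain z xy; rewrite /lt cz.
Qed.

(** A threshold for [d]: by nestedness, the elements above [x] are those that exceed it. *)
Let top (x : T) : nat := \max_(y | ~~ lt x y) d y.

Lemma lt_top x y : lt x y = (top x < d y).
Proof.
apply/idP/idP => [xy|]; last first.
  by apply: contraTT => nxy; rewrite -leqNgt; exact: leq_bigmax_cond.
(* Positivity lets the strict bound on the maximum be stated as the non-strict bound [(d y).-1]. *)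
have d_gt0 : 0 < d y by apply/card_gt0P; exists x; rewrite inE.
rewrite -[d y]prednK // ltnS; apply/bigmax_leqP=> z nxz.
by rewrite -ltnS prednK //; apply: strict_down_nested nxz.
Qed.

(* The parity of the key tells minimal from nonminimal elements, so that ties
   occur only within each kind. *)
Let key (x : T) : nat := if d x == 0 then (top x).*2.+1 else (d x).*2.

(** With length at most 1, the lower element is minimal and the upper one is not. For such a pair
    the keys compare as [2t+1 < 2d], which is [t < d]. *)
Lemma lt_key x y : lt x y = [&& d x == 0, 0 < d y & key x < key y].
Proof.
have [dx0|dx_gt0] /= := posnP (d x); last first.
  apply/negbTE; have /card_gt0P[z] := dx_gt0; rewrite inE => zx.
  exact: length1_no_chain zx.
have [dy0|dy_gt0] /= := posnP (d y); first by rewrite lt_top dy0.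
by rewrite lt_top /key dx0 eqxx (gtn_eqF dy_gt0); lia.
Qed.

(** The elements are sorted by [key], and the word marks the nonminimal ones. *)
Lemma length1_lineup (n : nat) : #|T| = n.+1 ->
  exists (v : n.-tuple bool) (f : 'I_n.+1 -> T),
    bijective f /\ forall i j, r (f i) (f j) = word_rel (false :: v) i j.
Proof.
have /and3P[/is_porderP[r_refl _ _] _ _] := semi_r.
move=> cardT; pose le := relpre key leq.
have le_trans : transitive le by move=> y x z; apply: leq_trans.
have le_refl : reflexive le by move=> x; apply: leqnn.
have le_total : total le by move=> x y; apply: leq_total.
have /card_gt0P[x0 _] : 0 < #|T| by rewrite cardT.
pose s := sort le (enum T).
have size_s : size s = n.+1 by rewrite size_sort -cardE.
have uniq_s : uniq s by rewrite sort_uniq enum_uniq.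
pose f (i : 'I_n.+1) := nth x0 s i.
have f_inj : injective f.
  by move=> i j /eqP; rewrite nth_uniq ?size_s // => /eqP/val_inj.
have fE i j :
    r (f i) (f j) = (i == j) || [&& i < j, d (f i) == 0 & 0 < d (f j)].
  have [->|nij] /= := eqVneq i j; first by rewrite r_refl.
  have -> : r (f i) (f j) = lt (f i) (f j).
    by rewrite /lt (inj_eq f_inj) nij andbT.
  rewrite lt_key [RHS]andbC -andbA.
  have [di|//] := eqVneq (d (f i)) 0; have [//|dj] /= := posnP (d (f j)).
  have [ij|ji] := ltnP i j.
    (* The left key is odd and the right one even, so the inequality is strict. *)
    have : key (f i) <= key (f j).
      by apply: (sorted_leq_nth le_trans le_refl) => //;
        rewrite ?inE ?size_s ?sort_sorted // ltnW.
    by rewrite /key di (gtn_eqF dj) /=; lia.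
  apply/negbTE; rewrite -leqNgt.
  by apply: (sorted_leq_nth le_trans le_refl);
    rewrite ?inE ?size_s ?sort_sorted.
have f_bij : bijective f by apply: inj_card_bij; rewrite // card_ord cardT.
have [g gK fK] := f_bij.
pose v := [tuple 0 < d (f (lift ord0 i)) | i < n].
have vE (i : 'I_n.+1) : nth false (false :: v) i = (0 < d (f i)).
  have [i' ->|->] := unliftP ord0 i; first by rewrite lift0 /= nth_mktuple.
  (* The first element is minimal: anything strictly below it would have an index less than 0. *)
  apply/esym/negbTE/negP=> /card_gt0P[x]; rewrite inE => /andP[+ nx].
  rewrite -[x]fK fE => /orP[/eqP e|/andP[]//].
  by move: nx; rewrite -[x]fK e eqxx.
exists v, f; split=> // i j.
by rewrite fE /word_rel !vE -eqn0Ngt.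
Qed.

End LengthOne.

(** * Counting the isomorphism classes *)

Lemma semiorder_length1_word n (R : {set 'I_n.+1 * 'I_n.+1}) :
  R \in semiorders_length_le 1 n.+1 ->
  exists v : n.-tuple bool, graph_iso (word_graph n.+1 (false :: v)) R.
Proof.
rewrite inE => /andP[semiR lenR].
have [v [f [f_bij fE]]] := length1_lineup semiR lenR (card_ord _).
exists v; apply/existsP; exists (perm (bij_inj f_bij)).
by apply/'forall_'forall_eqP=> i j; rewrite !permE fE rel_of_word_graph.
Qed.

Theorem theorem5p1 (n : nat) (hn : 1 <= n) :
  num_semiorders_length_le 1 n = 2 ^ (n - 1).
Proof.
case: n hn => // n _; rewrite subn1 /=.
have /equivalence_relP[iso_refl iso_ltrans] := @graph_iso_equiv 'I_n.+1.
set D := semiorders_length_le 1 n.+1.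
pose P (v : n.-tuple bool) := word_graph n.+1 (false :: v).
pose class R := [set S in D | graph_iso R S].
have PD v : P v \in D by apply: word_graph_semiorder.
(* Every class contains the poset of a word beginning with 0. *)
have -> : num_semiorders_length_le 1 n.+1 = #|[set class (P v) | v in setT]|.
  apply: eq_card => C; apply/imsetP/imsetP=> [[R RD ->]|[v _ ->]].
    have [v vR] := semiorder_length1_word RD; exists v => //.
    by apply/setP=> S; rewrite !inE (iso_ltrans _ _ vR).
  by exists (P v); first exact: PD.
(* For injectivity: [P w] lies in its own class, so equal classes make [P v] and [P w]
   isomorphic. *)
rewrite card_imset ?cardsT ?card_tuple ?card_bool // => v w /setP/(_ (P w)).
rewrite inE [RHS]inE PD iso_refl => /existsP[g /'forall_'forall_eqP gE].
apply/val_inj/word_rel_iso_inj; first by rewrite !size_tuple.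
rewrite size_tuple; apply/existsP; exists g; apply/'forall_'forall_eqP=> i j.
by have := gE i j; rewrite !rel_of_word_graph.
Qed.
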